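(* Let $B$ be a symmetric positive definite $d\times d$ real matrix. Let $(x_i^0)_{i\in\{1,\dots,n\}}\in(\mathbb{R}^d)^n$ be an initial configuration such that 1. the vertices $v=(v_1,\dots,v_\kappa)$ of $\mathcal{K}:=\mathrm{conv}\{x_i^0\}_{i\in\{1,\dots,n\}}$ satisfy $v_j\in\mathscr{C}_j(v)\setminus\bigcup_{i\ne j}\mathscr{C}_i(v)$ for every $j\in\{1,\dots,\kappa\}$; 2. if $x_i^0$ is not a vertex of $\mathcal{K}$, then it does not lie on any face shared by two adjacent cells, i.e. $x_i^0\notin\mathscr{C}_k(v)\cap\mathscr{C}_l(v)$ for $k\ne l$. Then for any $T>0$, the Cauchy problem $$\dot x_i(t)=\operatorname*{arg\,max}_{y\in\{x_j(t)\}_{j\in\{1,\dots,n\}}}\langle Bx_i(t),y\rangle-x_i(t),\qquad x_i(0)=x_i^0,\qquad i\in\{1,\dots,n\},$$ admits a unique solution $(x_i(\cdot))_{i\in\{1,\dots,n\}}\in C^0([0,T];(\mathbb{R}^d)^n)$. This solution is continuous with respect to the initial data, and satisfies $x_i(t)\in\mathcal{K}$ for all $i\in\{1,\dots,n\}$ and all times $t\ge 0$ in its interval of definition.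
   Context: $\langle\cdot,\cdot\rangle$ is the Euclidean inner product on $\mathbb{R}^d$, and $\mathrm{conv}$ is the convex hull. For a convex polytope $\mathcal{K}\subset\mathbb{R}^d$ with vertices $v=(v_1,\dots,v_\kappa)$, the cells are $$\mathscr{C}_i(v):=\left\{x\in\mathcal{K}:\ \langle Bx,v_i\rangle=\max_{y\in\mathcal{K}}\langle Bx,y\rangle\right\},\qquad i\in\{1,\dots,\kappa\}.$$ A solution on $[0,T]$ is a continuous curve attaining the initial data at $t=0$ and satisfying the differential equation for $0<t<T$; the symbol $\arg\max$ denotes the maximizer, treated as a single point. Continuity with respect to the initial data means that the map sending an initial configuration satisfying conditions 1 and 2 to the corresponding solution in $C^0([0,T];(\mathbb{R}^d)^n)$ is continuous. *)

(* Defs.v *)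
From HB Require Import structures.
From mathcomp Require Import all_boot all_order all_algebra.
From mathcomp Require Import all_classical all_reals all_analysis.

Set Implicit Arguments.
Unset Strict Implicit.
Unset Printing Implicit Defensive.

Import Order.TTheory GRing.Theory Num.Theory numFieldNormedType.Exports.

Local Open Scope classical_set_scope.
Local Open Scope ring_scope.

Definition dotv (R : realType) (d : nat) (u v : 'cV[R]_d) : R :=
  (u^T *m v) 0 0.

Definition sym_posdef (R : realType) (d : nat) (B : 'M[R]_d) : Prop :=
  B^T = B /\ forall u : 'cV[R]_d, u != 0 -> 0 < dotv (B *m u) u.

(* A configuration of n points of R^d is a matrix 'M[R]_(d, n) whose i-th
   column is the i-th point; its library topology, that of entrywise
   convergence, is the one of (R^d)^n. *)
Definition points (R : realType) (d n : nat) (x : 'M[R]_(d, n)) :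
  set 'cV[R]_d := range (fun i => col i x).

Definition conv_hull (R : realType) (d : nat) (A : set 'cV[R]_d) :
  set 'cV[R]_d := smallest (@convex_set R 'cV[R]_d) A.

(* For a polytope, the vertices are the extreme points. *)
Definition vertices (R : realType) (d : nat) (K : set 'cV[R]_d) :
  set 'cV[R]_d :=
  [set p | K p /\ forall (a b : 'cV[R]_d) (t : R), K a -> K b ->
     0 < t < 1 -> p = t *: a + (1 - t) *: b -> a = p /\ b = p].

Definition is_max (R : realType) (A : set R) (m : R) : Prop :=
  A m /\ ubound A m.

(* Cells are indexed by the vertex itself instead of its rank in an
   enumeration v_1, ..., v_kappa of the vertices. *)
Definition cell (R : realType) (d : nat) (B : 'M[R]_d) (K : set 'cV[R]_d)
  (p : 'cV[R]_d) : set 'cV[R]_d :=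
  [set x | K x /\ is_max [set dotv (B *m x) y | y in K] (dotv (B *m x) p)].

Definition admissible (R : realType) (d n : nat) (B : 'M[R]_d) :
  set 'M[R]_(d, n) :=
  [set x | let K := conv_hull (points x) in
     (forall p, vertices K p ->
        (cell B K p `\` \bigcup_(q in vertices K `\ p) cell B K q) p) /\
     (forall i : 'I_n, ~ vertices K (col i x) ->
        forall p q, vertices K p -> vertices K q -> p <> q ->
          ~ (cell B K p `&` cell B K q) (col i x))].

Definition argmax (R : realType) (d : nat) (f : 'cV[R]_d -> R)
  (A : set 'cV[R]_d) : set 'cV[R]_d :=
  [set y | A y /\ forall z, A z -> f z <= f y].

(* The right-hand side of the equation makes sense only when the maximizer,
   as a point of R^d, is unique; several indices may realize it.
   Only the values of x on [0, T] matter. *)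
Definition solution (R : realType) (d n : nat) (B : 'M[R]_d) (T : R)
  (x0 : 'M[R]_(d, n)) (x : R -> 'M[R]_(d, n)) : Prop :=
  [/\ {within `[0, T], continuous x},
      x 0 = x0 &
      forall (t : R) (i : 'I_n), 0 < t < T ->
        exists2 y : 'cV[R]_d,
          argmax (dotv (B *m col i (x t))) (points (x t)) = [set y] &
          is_derive t 1 (fun s => col i (x s)) (y - col i (x t))].

(* Main.v *)
(** Each point x_i of an admissible configuration has a unique maximizer q_i
among the points, and q_i is its own maximizer: the maximizers of a linear form
on a finite set include a vertex of the hull, and even two vertices if they are
not unique.  Along x_i(t) = exp(-t) x_i + (1 - exp(-t)) q_i these strict
inequalities persist, so the explicit curve is a solution.  Coinciding points
could a priori separate in another solution, so uniqueness is proved for the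
whole group of points sharing a maximizer, by a contraction estimate on short
intervals.  Finally, the assignment of maximizers is locally constant up to
coinciding points, and for a fixed assignment the explicit curve is
1-Lipschitz in the initial configuration. *)

Require Import Defs.
From mathcomp Require Import all_boot all_order all_algebra.
From mathcomp Require Import all_classical all_reals all_analysis.
From mathcomp Require Import ring lra.
Import Order.TTheory GRing.Theory Num.Theory numFieldNormedType.Exports.
Local Open Scope classical_set_scope.
Local Open Scope ring_scope.

(** * Algebra of the Euclidean inner product *)

Lemma dotvDl {R : realType} {d : nat} (u v w : 'cV[R]_d) :
  dotv (u + v) w = dotv u w + dotv v w.
Proof. by rewrite /dotv linearD mulmxDl mxE. Qed.

Lemma dotvZl {R : realType} {d : nat} (a : R) (u w : 'cV[R]_d) :
  dotv (a *: u) w = a * dotv u w.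
Proof. by rewrite /dotv linearZ -scalemxAl mxE. Qed.

Lemma dotvDr {R : realType} {d : nat} (u v w : 'cV[R]_d) :
  dotv u (v + w) = dotv u v + dotv u w.
Proof. by rewrite /dotv mulmxDr mxE. Qed.

Lemma dotvZr {R : realType} {d : nat} (a : R) (u w : 'cV[R]_d) :
  dotv u (a *: w) = a * dotv u w.
Proof. by rewrite /dotv -scalemxAr mxE. Qed.

Lemma dotvE {R : realType} {d : nat} (u v : 'cV[R]_d) :
  dotv u v = \sum_i u i 0 * v i 0.
Proof. by rewrite /dotv mxE; apply: eq_bigr => i _; rewrite mxE. Qed.

Lemma dotv_ge0 {R : realType} {d : nat} (u : 'cV[R]_d) : 0 <= dotv u u.
Proof. by rewrite dotvE sumr_ge0// => i _; rewrite -expr2 sqr_ge0. Qed.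

Lemma dotv_eq0 {R : realType} {d : nat} (u : 'cV[R]_d) :
  (dotv u u == 0) = (u == 0).
Proof.
apply/eqP/eqP => [|->]; last by rewrite /dotv mulmx0 mxE.
rewrite dotvE => /eqP; rewrite psumr_eq0; last first.
  by move=> i _; rewrite -expr2 sqr_ge0.
move=> /allP h; apply/colP => i; rewrite mxE; apply/eqP.
by have := h i (mem_index_enum i); rewrite mulf_eq0 orbb.
Qed.

(** Strict convexity of the squared distance to [p], made quantitative by the last term. *)
Lemma dotv_conv_sub {R : realType} {d : nat} (a b p : 'cV[R]_d) (t : R) :
  dotv (t *: a + (1 - t) *: b - p) (t *: a + (1 - t) *: b - p) =
  t * dotv (a - p) (a - p) + (1 - t) * dotv (b - p) (b - p)
  - t * (1 - t) * dotv (a - b) (a - b).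
Proof.
rewrite !dotvE !mulr_sumr -!big_split/= -sumrB; apply: eq_bigr => i _.
by rewrite !mxE; ring.
Qed.

(** * Convex hulls and vertices maximizing a linear form *)

Lemma conv_hull_sub {R : realType} {d : nat} (A C : set 'cV[R]_d) :
  A `<=` C ->
  (forall a b t, C a -> C b -> 0 < t < 1 -> C (t *: a + (1 - t) *: b)) ->
  conv_hull A `<=` C.
Proof.
move=> AC cC; apply: smallest_sub => //.
apply/convex_setW => a b; rewrite !inE => Ca Cb k k0 k1; rewrite inE.
by apply: cC => //; rewrite k0.
Qed.

Lemma sub_conv_hull {R : realType} {d : nat} (A : set 'cV[R]_d) :
  A `<=` conv_hull A.
Proof. exact: sub_gen_smallest. Qed.

Lemma conv_hull_conv {R : realType} {d : nat} (A : set 'cV[R]_d)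
    (a b : 'cV[R]_d) (t : R) : conv_hull A a -> conv_hull A b -> 0 <= t <= 1 ->
  conv_hull A (t *: a + (1 - t) *: b).
Proof.
move=> Aa Ab t01 C [cC AC].
have k01 : Itv.spec (@Itv.num_sem R) (Itv.Real `[0%Z, 1%Z]) t.
  by rewrite /= /Itv.num_sem/= num_real in_itv/=.
have := cC a b (Itv.Def k01).
rewrite !inE; apply; [exact: Aa|exact: Ab].
Qed.

(* Among the maximizers of a linear form on a finite set, one lying farthest
   from p is extreme, as the squared distance to p is strictly convex. *)
Lemma maximizing_vertex {R : realType} {d n : nat} (x : 'M[R]_(d, n))
    (u p : 'cV[R]_d) (k : 'I_n) :
  (forall i, dotv u (col i x) <= dotv u (col k x)) ->
  exists l, [/\ vertices (conv_hull (points x)) (col l x),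
    dotv u (col l x) = dotv u (col k x) &
    (col k x <> p -> col l x <> p)].
Proof.
move=> kmax; set m := dotv u (col k x).
pose phi (y : 'cV[R]_d) := dotv (y - p) (y - p).
pose P l := dotv u (col l x) == m.
have Pk : P k by exact: eqxx.
case: (@arg_maxP _ _ _ k P (fun l => phi (col l x)) Pk) => l /eqP Pl lmax.
(* The right-hand set is convex: a proper convex combination reaching the maximum [m] forces both
   ends to reach it. *)
have hC : conv_hull (points x) `<=`
    [set y | dotv u y <= m /\ (dotv u y = m -> phi y <= phi (col l x))].
  apply: conv_hull_sub => [_ [i _ <-]|a b t [ua pa] [ub pb] /andP[t0 t1]].
    by split => // /eqP; exact: lmax.
  split; rewrite dotvDr !dotvZr; first by nra.
  move=> e; have ea : dotv u a = m by nra.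
  have eb : dotv u b = m by nra.
  rewrite {1}/phi dotv_conv_sub -/(phi a) -/(phi b).
  have := pa ea; have := pb eb; have := dotv_ge0 (a - b) => ab0 h1 h2.
  have t1' : 0 < 1 - t by lra.
  have : 0 <= t * (1 - t) * dotv (a - b) (a - b).
    by rewrite mulr_ge0// mulr_ge0 ?ltW.
  have : 0 <= t * (phi (col l x) - phi a).
    by apply: mulr_ge0; [exact: ltW|rewrite subr_ge0].
  have : 0 <= (1 - t) * (phi (col l x) - phi b).
    by apply: mulr_ge0; [exact: ltW|rewrite subr_ge0].
  by lra.
exists l; split => //.
- split; first by apply: sub_conv_hull; exists l.
  move=> a b t Ka Kb /andP[t0 t1] e.
  have [ua pa] := hC _ Ka; have [ub pb] := hC _ Kb.
  have t1' : 0 < 1 - t by lra.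
  have eul : dotv u (col l x) = t * dotv u a + (1 - t) * dotv u b.
    by rewrite e dotvDr !dotvZr.
  (* Both ends are maximizers, hence no farther from [p] than [col l x]; the quadratic term then
     forces [a = b]. *)
  have {}pa : phi a <= phi (col l x) by apply: pa; nra.
  have {}pb : phi b <= phi (col l x) by apply: pb; nra.
  have el : phi (col l x) = t * phi a + (1 - t) * phi b
      - t * (1 - t) * dotv (a - b) (a - b).
    by rewrite {1}e /phi dotv_conv_sub.
  have tt : 0 < t * (1 - t) by rewrite mulr_gt0.
  have ab0 := dotv_ge0 (a - b).
  have : dotv (a - b) (a - b) == 0 by rewrite eq_le ab0 andbT; nra.
  rewrite dotv_eq0 subr_eq0 => /eqP ab; subst b.
  by rewrite e -scalerDl addrC subrK scale1r.
- move=> kp lp; apply: kp.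
  have : phi (col k x) <= phi (col l x) := lmax k Pk.
  have -> : phi (col l x) = 0 by apply/eqP; rewrite dotv_eq0 subr_eq0 lp.
  by move=> k0; apply/eqP; rewrite -subr_eq0 -dotv_eq0 eq_le k0 dotv_ge0.
Qed.

(* [j i] indexes the maximizer for the i-th point; it is strict only against
   points distinct from it, since several indices may carry the same point. *)
Definition leader {R : realType} {d n : nat} (B : 'M[R]_d) (x : 'M[R]_(d, n))
    (j : 'I_n -> 'I_n) : Prop :=
  (forall i k, col k x <> col (j i) x ->
    dotv (B *m col i x) (col k x) < dotv (B *m col i x) (col (j i) x)) /\
  (forall i, col (j (j i)) x = col (j i) x).

(** * From admissible configurations to leaders *)

Lemma conv_hull_le {R : realType} {d n : nat} (x : 'M[R]_(d, n))
    (u : 'cV[R]_d) (m : R) : (forall i, dotv u (col i x) <= m) ->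
  forall y, conv_hull (points x) y -> dotv u y <= m.
Proof.
move=> um; apply: conv_hull_sub => [_ [i _ <-]//|a b t /= ua ub /andP[t0 t1]].
by rewrite dotvDr !dotvZr; nra.
Qed.

Lemma cellP {R : realType} {d n : nat} (B : 'M[R]_d) (x : 'M[R]_(d, n))
    (i l : 'I_n) :
  (forall k, dotv (B *m col i x) (col k x) <= dotv (B *m col i x) (col l x)) ->
  cell B (conv_hull (points x)) (col l x) (col i x).
Proof.
move=> lmax; split; first by apply: sub_conv_hull; exists i.
split; first by exists (col l x) => //; apply: sub_conv_hull; exists l.
by move=> _ [y Ky <-]; exact: conv_hull_le Ky.
Qed.

Lemma admissible_leader {R : realType} {d n : nat} {B : 'M[R]_d}
    {x : 'M[R]_(d, n)} : admissible B x -> exists j, leader B x j.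
Proof.
move=> [/= hv hn]; set K := conv_hull (points x) in hv hn.
have vmax i : vertices K (col i x) -> forall k, col k x <> col i x ->
    dotv (B *m col i x) (col k x) < dotv (B *m col i x) (col i x).
  move=> vi; have [[_ [_ ub]] others] := hv _ vi.
  have le k : dotv (B *m col i x) (col k x) <= dotv (B *m col i x) (col i x).
    by apply: ub; exists (col k x) => //; apply: sub_conv_hull; exists k.
  move=> k ki; rewrite lt_neqAle le andbT; apply/eqP => e.
  (* A tie at [k] yields a maximizing vertex other than [col i x] whose cell contains [col i x],
     against condition 1. *)
  have [|l [vl el lk]] := @maximizing_vertex _ _ _ x (B *m col i x) (col i x) k.
    by move=> m; rewrite e.
  apply: others; exists (col l x); first by split => //; exact: lk.
  by apply: cellP => m; rewrite el e.
suff /choice[j hj] : forall i, exists l, vertices K (col l x) /\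
    forall k, col k x <> col l x ->
      dotv (B *m col i x) (col k x) < dotv (B *m col i x) (col l x).
  exists j; split => [i k|i]; first exact: (hj i).2.
  (* [col (j i) x] is a vertex, so by [vmax] nothing else can maximize its form. *)
  apply: contrapT => /eqP; rewrite eq_sym => /eqP e.
  have := (hj (j i)).2 _ e; rewrite ltNge; apply/negP; rewrite negbK ltW//.
  by apply: vmax; [exact: (hj i).1|exact/nesym].
move=> i; have [vi|nvi] := pselect (vertices K (col i x)).
  by exists i; split => //; exact: vmax.
pose f k := dotv (B *m col i x) (col k x).
case: (@arg_maxP _ _ _ i xpredT f isT) => m _ mmax.
have [|l [vl el _]] := @maximizing_vertex _ _ _ x (B *m col i x) 0 m.
  by move=> k; exact: mmax.
have lmax k : f k <= f l by rewrite /f el; exact: mmax.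
exists l; split => // k kl; rewrite lt_neqAle lmax andbT; apply/eqP => e.
(* With [col l x] as base point, a tie gives a second maximizing vertex, so [col i x] would lie in
   two cells, against condition 2. *)
have [|l' [vl' el' h]] := @maximizing_vertex _ _ _ x (B *m col i x) (col l x) k.
  by move=> k'; rewrite e; exact: lmax.
apply: (hn i nvi _ _ vl vl' (nesym (h kl))).
by split; apply: cellP => k'; rewrite ?el' ?e; exact: lmax.
Qed.

(** * The explicit flow *)

Lemma is_derive_mxP {R : realType} {m n : nat} (M : R -> 'M[R]_(m, n))
    (D : 'M[R]_(m, n)) (t : R) :
  is_derive t 1 M D <-> forall r c, is_derive t 1 (fun s => M s r c) (D r c).
Proof.
split=> [[dM <-] r c|h].
  by rewrite derive_mx// mxE; split=> //; have /derivable_mxP := dM.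
have dM : derivable M t 1 by apply/derivable_mxP => r c; case: (h r c).
split=> //; rewrite derive_mx//; apply/matrixP => r c.
by rewrite mxE; case: (h r c).
Qed.

(** Coinciding points define the same linear form, and two distinct strict maximizers would beat
    each other. *)
Lemma leader_congr {R : realType} {d n : nat} {B : 'M[R]_d} {x : 'M[R]_(d, n)}
    {j : 'I_n -> 'I_n} {k l : 'I_n} :
  leader B x j -> col k x = col l x -> col (j k) x = col (j l) x.
Proof.
move=> [h _] kl; apply: contrapT => ne.
have := h l (j k) ne; have := h k (j l) (nesym ne).
by rewrite kl => /lt_trans /[apply]; rewrite ltxx.
Qed.

Lemma leader_argmax {R : realType} {d n : nat} {B : 'M[R]_d}
    {x : 'M[R]_(d, n)} {j : 'I_n -> 'I_n} (i : 'I_n) :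
  leader B x j ->
  argmax (dotv (B *m col i x)) (points x) = [set col (j i) x].
Proof.
move=> [h _]; apply/seteqP; split => [_ [[k _ <-] kmax]|_ ->] /=.
  apply: contrapT => /(h i); apply/negP; rewrite -leNgt.
  by apply: kmax; exists (j i).
split; first by exists (j i).
move=> _ [k _ <-]; have [->//|/eqP ne] := eqVneq (col k x) (col (j i) x).
exact/ltW/h.
Qed.

(** The solution of the linear system in which each target is frozen at its initial position
    [col (j i) x]. *)
Definition flow {R : realType} {d n : nat} (x : 'M[R]_(d, n))
    (j : 'I_n -> 'I_n) (t : R) : 'M[R]_(d, n) :=
  \matrix_(r, i) (expR (- t) * x r i + (1 - expR (- t)) * x r (j i)).

Lemma flow0 {R : realType} {d n : nat} (x : 'M[R]_(d, n)) (j : 'I_n -> 'I_n) :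
  flow x j 0 = x.
Proof.
by apply/matrixP => r i; rewrite mxE oppr0 expR0 subrr mul0r addr0 mul1r.
Qed.

Lemma col_flow {R : realType} {d n : nat} (x : 'M[R]_(d, n))
    (j : 'I_n -> 'I_n) (t : R) (i : 'I_n) :
  col i (flow x j t) =
  expR (- t) *: col i x + (1 - expR (- t)) *: col (j i) x.
Proof. by apply/colP => r; rewrite !mxE. Qed.

Lemma is_derive_flow {R : realType} {d n : nat} (x : 'M[R]_(d, n))
    (j : 'I_n -> 'I_n) (t : R) (i : 'I_n) :
  is_derive t 1 (fun s => col i (flow x j s))
    (col (j i) x - col i (flow x j t)).
Proof.
apply/is_derive_mxP => r c; rewrite !mxE.
have e : is_derive t (1 : R) (fun s : R => expR (- s)) (- expR (- t)).
  have := is_derive1_comp (is_derive_expR (- t)) (is_deriveNid t (1 : R)).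
  by rewrite mulrN mulr1.
rewrite (_ : (fun s => _) =
    (cst (x r (j i)) + (x r i - x r (j i)) \*: (fun s : R => expR (- s)))).
  have := is_deriveD (is_derive_cst (x r (j i)) t (1 : R))
    (is_deriveZ (x r i - x r (j i)) e).
  move=> /is_derive_eq; apply; rewrite add0r.
  by rewrite /GRing.scale/=; ring.
apply/funext => s; rewrite !mxE.
transitivity (x r (j i) + (x r i - x r (j i)) * expR (- s)); last by [].
by ring.
Qed.

Lemma flow_continuous {R : realType} {d n : nat} (x : 'M[R]_(d, n))
    (j : 'I_n -> 'I_n) : continuous (flow x j).
Proof.
move=> t; apply/differentiable_continuous/derivable1_diffP/derivable_mxP => r i.
have /is_derive_mxP/(_ r 0) := is_derive_flow x j t i.
case; rewrite (_ : (fun s => col i _ r 0) = fun s => flow x j s r i)//.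
by apply/funext => s; rewrite !mxE.
Qed.

(** A point located at a leader is its own target, so the flow does not move it. *)
Lemma leader_col_flow {R : realType} {d n : nat} {B : 'M[R]_d}
    {x : 'M[R]_(d, n)} {j : 'I_n -> 'I_n} (t : R) {i k : 'I_n} :
  leader B x j -> col k x = col (j i) x -> col k (flow x j t) = col (j i) x.
Proof.
move=> hj ki; rewrite col_flow ki (leader_congr hj ki) hj.2 -scalerDl addrC.
by rewrite subrK scale1r.
Qed.

(** By bilinearity, the gap at time [t] is a combination of four initial gaps with weights [e * e],
    [e * (1 - e)] twice and [(1 - e) * (1 - e)]; the first term is positive, the others
    nonnegative. *)
Lemma leader_flow {R : realType} {d n : nat} {B : 'M[R]_d} {x : 'M[R]_(d, n)}
    {j : 'I_n -> 'I_n} {t : R} :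
  leader B x j -> 0 <= t -> leader B (flow x j t) j.
Proof.
move=> hj t0; have jflow i := leader_col_flow t hj (erefl (col (j i) x)).
split=> [i k|i]; rewrite !jflow; last exact: hj.2.
move=> ne; have xk : col k x <> col (j i) x.
  by move=> e; apply: ne; apply: leader_col_flow hj e.
rewrite !col_flow; set e := expR (- t).
have e0 : 0 < e := expR_gt0 _.
have e1 : e <= 1 by rewrite expR_le1 oppr_le0.
rewrite -subr_gt0 !(mulmxDr, dotvDl, dotvDr, =^~ scalemxAr, dotvZl, dotvZr).
have h1 := hj.1 i k xk.
have le i' k' : dotv (B *m col i' x) (col k' x)
    <= dotv (B *m col i' x) (col (j i') x).
  by have [->//|/eqP ?] := eqVneq (col k' x) (col (j i') x); exact/ltW/hj.1.
have h2 := le i (j k); have h3 := le (j i) k; have h4 := le (j i) (j k).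
rewrite hj.2 in h3 h4.
set c1 := dotv (B *m col i x) (col k x) in h1 *.
set c2 := dotv (B *m col i x) (col (j k) x) in h2 *.
set c3 := dotv (B *m col (j i) x) (col k x) in h3 *.
set c4 := dotv (B *m col (j i) x) (col (j k) x) in h4 *.
set q1 := dotv (B *m col i x) (col (j i) x) in h1 h2 *.
set q2 := dotv (B *m col (j i) x) (col (j i) x) in h3 h4 *.
have f0 : 0 <= 1 - e by rewrite subr_ge0.
rewrite [ltRHS](_ : _ = e * e * (q1 - c1) + (e * (1 - e) * (q2 - c3)
    + (e * (1 - e) * (q1 - c2) + (1 - e) * (1 - e) * (q2 - c4)))); last by ring.
by rewrite ltr_wpDr// ?addr_ge0 ?mulr_ge0 ?mulr_gt0 ?subr_gt0 ?subr_ge0// ltW.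
Qed.

(** * Stability under perturbation, and existence *)

Lemma dotv_mulmx_continuous {R : realType} {d n : nat} (B : 'M[R]_d)
    (i k : 'I_n) :
  continuous (fun x : 'M[R]_(d, n) => dotv (B *m col i x) (col k x)).
Proof.
move=> x; rewrite (_ : (fun x => _) = fun x : 'M[R]_(d, n) =>
    \sum_a (\sum_b B a b * x b i) * x a k); last first.
  apply/funext => y; rewrite dotvE; apply: eq_bigr => a _; rewrite !mxE.
  by congr (_ * _); apply: eq_bigr => b _; rewrite mxE.
apply: (cvg_big _ (nbhs_filter x)); first exact: add_continuous.
move=> a _; apply: cvgM; last exact: coord_continuous.
apply: (cvg_big _ (nbhs_filter x)); first exact: add_continuous.
by move=> b _; apply: cvgM;
  [exact: cvg_cst|exact: coord_continuous].
Qed.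

(** Finitely many strict inequalities between continuous functions persist nearby. Distinctness is
    tested at [x], since points coinciding at [x] may separate at [y]. *)
Lemma leader_near {R : realType} {d n : nat} {B : 'M[R]_d} {x : 'M[R]_(d, n)}
    {j : 'I_n -> 'I_n} : leader B x j ->
  \forall y \near x, forall i k, col k x <> col (j i) x ->
    dotv (B *m col i y) (col k y) < dotv (B *m col i y) (col (j i) y).
Proof.
move=> hj; apply: (filter_forall (nbhs_filter x)) => i.
apply: (filter_forall (nbhs_filter x)) => k.
have [e|ne] := pselect (col k x = col (j i) x).
  by apply: nearW => y; rewrite e.
near=> y => _; rewrite -subr_gt0; near: y.
pose g (y : 'M[R]_(d, n)) :=
  dotv (B *m col i y) (col (j i) y) - dotv (B *m col i y) (col k y).
have cg : continuous g.
  by move=> y; apply: cvgB; [exact: nbhs_filter|exact: dotv_mulmx_continuous..].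
by apply: (cvgr_gt (g x) (cg x)); rewrite subr_gt0; exact: hj.1.
Unshelve. all: by end_near. Qed.

Lemma mx_norm_leP {R : realType} {m n : nat} (x : 'M[R]_(m, n)) {M : R} :
  0 <= M -> (`|x| <= M) <-> (forall r c, `|x r c| <= M).
Proof.
move=> M0; rewrite [X in (X <= _) <-> _]/Num.norm/= mx_normrE.
split=> [/bigmax_leP[_ h] r c|h]; first exact: (h (r, c)).
by apply/bigmax_leP; split=> // -[r c] _; exact: h.
Qed.

Lemma solution_flow {R : realType} {d n : nat} {B : 'M[R]_d}
    {x : 'M[R]_(d, n)} {j : 'I_n -> 'I_n} (T : R) :
  leader B x j -> solution B T x (flow x j).
Proof.
move=> hj; split; [|exact: flow0|].
  by apply: continuous_subspaceT; exact: flow_continuous.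
move=> t i /andP[/ltW t0 _]; exists (col (j i) x).
  rewrite (leader_argmax _ (leader_flow hj t0)).
  by rewrite (leader_col_flow t hj (erefl (col (j i) x))).
exact: is_derive_flow.
Qed.

Lemma conv_hull_flow {R : realType} {d n : nat} (x : 'M[R]_(d, n))
    (j : 'I_n -> 'I_n) (t : R) (i : 'I_n) :
  0 <= t -> conv_hull (points x) (col i (flow x j t)).
Proof.
move=> t0; rewrite col_flow; apply: conv_hull_conv.
- by apply: sub_conv_hull; exists i.
- by apply: sub_conv_hull; exists (j i).
- by rewrite expR_ge0 expR_le1 oppr_le0.
Qed.

(** * Uniqueness *)

(** The supremum of the agreement times before a putative disagreement [t1] is an agreement time by
    continuity, and the local extension goes past it. *)
Lemma eq_on_segment {R : realType} {V : normedModType R} (T : R)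
    (f g : R -> V) :
  {within `[0, T], continuous f} -> {within `[0, T], continuous g} ->
  f 0 = g 0 ->
  (forall s, 0 <= s < T -> f s = g s ->
    exists2 h, 0 < h & forall t, s <= t <= s + h -> t <= T -> f t = g t) ->
  forall t, 0 <= t <= T -> f t = g t.
Proof.
move=> cf cg fg0 step t1 /andP[t10 t1T]; apply: contrapT => ne.
pose Z := [set t | 0 <= t <= t1 /\ f t = g t].
have Z0 : Z 0 by rewrite /Z/= lexx.
have hsZ : has_sup Z by split; [exists 0|exists t1 => t [/andP[]]].
pose s := sup Z.
have s0 : 0 <= s := sup_upper_bound hsZ Z0.
have st1 : s <= t1 by apply: ge_sup; [exists 0|move=> t [/andP[]]].
have fgs : f s = g s.
  apply: contrapT => nes.
  have /subspace_continuousP/(_ s) := within_continuousB cf cg.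
  rewrite /= in_itv/= s0 (le_trans st1 t1T) => /(_ isT) c.
  have d0 : 0 < `|f s - g s| by rewrite normr_gt0 subr_eq0; exact/eqP.
  have : \forall t \near s, `[0, T]%classic t -> 0 < `|f t - g t|.
    exact: (cvgr_norm_gt _ c _ d0).
  move=> /nbhs_ballP[e /= e0 he].
  have [t [/andP[t0 tt1] fgt] st] := sup_adherent e0 hsZ.
  have ts : t <= s by apply: sup_upper_bound => //; rewrite /Z/= t0.
  have := he t; rewrite /ball/= ger0_norm ?subr_ge0//.
  rewrite /= in_itv/= t0 (le_trans tt1 t1T) fgt subrr normr0 ltxx.
  have ste : s - t < e by rewrite ltrBlDl -ltrBlDr.
  by move=> /(_ ste isT).
have {}st1 : s < t1.
  by rewrite lt_neqAle st1 andbT; apply/eqP => e; apply: ne; rewrite -e.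
have [|h h0 hs] := step s _ fgs; first by rewrite s0 (lt_le_trans st1 t1T).
pose t := Num.min (s + h) t1.
have st : s < t by rewrite lt_min ltrDl h0 st1.
have tt1 : t <= t1 by rewrite ge_min lexx orbT.
have : Z t.
  split; first by rewrite (le_trans s0 (ltW st)).
  by apply: hs; [rewrite (ltW st) ge_min lexx|exact: le_trans t1T].
by move/(sup_upper_bound hsZ); rewrite leNgt st.
Qed.

(** No point reaches a leader in finite time, as the weight [expR (- t)] of its initial position
    never vanishes. *)
Lemma leader_col_flow_inv {R : realType} {d n : nat} {B : 'M[R]_d}
    {x : 'M[R]_(d, n)} {j : 'I_n -> 'I_n} {t : R} {i k : 'I_n} :
  leader B x j -> 0 <= t ->
  col k (flow x j t) = col (j i) (flow x j t) -> col k x = col (j i) x.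
Proof.
move=> hj t0 e; have jflow l := leader_col_flow t hj (erefl (col (j l) x)).
have := leader_congr (leader_flow hj t0) e; rewrite !jflow hj.2 => jki.
move: e; rewrite jflow col_flow jki => /eqP.
rewrite -[X in _ == X]scale1r -subr_eq0 -addrA -scalerBl addrAC subrr sub0r.
rewrite scaleNr -scalerBr scaler_eq0 gt_eqF ?expR_gt0//= subr_eq0.
by move/eqP.
Qed.

(* The error e = x' - flow vanishes at s and, as long as each maximizer stays
   in the group of points that coincided with it at time s, satisfies
   e_i' = e_k - e_i for some k depending on the time.  On an interval of length
   at most 1/4 this makes the supremum of |e| at most half of itself. *)
Lemma solution_unique_step {R : realType} {d n : nat} {B : 'M[R]_d}
    {x : 'M[R]_(d, n)} {j : 'I_n -> 'I_n} {T s : R} {x' : R -> 'M[R]_(d, n)} :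
  leader B x j -> solution B T x x' -> 0 <= s < T -> x' s = flow x j s ->
  exists2 h, 0 < h &
    forall t, s <= t <= s + h -> t <= T -> x' t = flow x j t.
Proof.
move=> hj [cx' _ dx'] /andP[s0 sT] x's.
have cs : x' @ within `[0, T] (nbhs s) --> flow x j s.
  rewrite -x's; have /subspace_continuousP/(_ s) := cx'; apply.
  by rewrite /= in_itv/= s0 ltW.
have /nbhs_ballP[e /= e0 he] := cs _ (leader_near (leader_flow hj s0)).
have e2 : 0 < e / 2 by rewrite divr_gt0.
have q4 : 0 < (1 / 4 : R) by [].
(* The three bounds keep [t] in the ball of radius [e] around [s], give the contraction factor, and
   keep [t] below [T]. *)
pose h := Num.min (Num.min (e / 2) (1 / 4)) (T - s).
have h0 : 0 < h by rewrite !lt_min e2 subr_gt0 sT q4.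
have he2 : h <= e / 2 by rewrite /h !ge_min lexx.
have h4 : h <= 1 / 4 by rewrite /h !ge_min lexx orbT.
have hT : s + h <= T by rewrite addrC -lerBrDr /h ge_min lexx orbT.
pose E t := x' t - flow x j t.
have cE : {within `[s, s + h], continuous E}.
  apply: within_continuousB.
    apply: continuous_subspaceW cx' => t /=; rewrite !in_itv/= => /andP[st th].
    by rewrite (le_trans s0 st) (le_trans th hT).
  by apply: continuous_subspaceT; exact: flow_continuous.
have dE t i : s < t < s + h -> exists k, forall r,
    is_derive t 1 (fun u => E u r i) (E t r k - E t r i).
  move=> /andP[st th]; have t0 := le_lt_trans s0 st.
  have tT := lt_le_trans th hT.
  have [|y] := dx' t i; first by rewrite t0.
  move=> /seteqP[_ /(_ y erefl)] [[k _ <-] kmax] dy.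
  exists k => r.
  (* An index outside the group at time [s] would still be strictly beaten by [j i] at time [t]. *)
  have ki : col k x = col (j i) x.
    apply: (leader_col_flow_inv hj s0); apply: contrapT => ne.
    have := he t; rewrite /ball/= ltr0_norm ?subr_lt0// opprB.
    have te : t - s < e by lra.
    rewrite /= in_itv/= (ltW t0) (ltW tT) te => /(_ isT isT i k ne).
    by apply/negP; rewrite -leNgt; apply: kmax; exists (j i).
  have /is_derive_mxP/(_ r 0) d1 := dy.
  have /is_derive_mxP/(_ r 0) d2 := is_derive_flow x j t i.
  have := is_deriveB d1 d2.
  rewrite (_ : (fun u => col i (x' u) r 0) - _ = fun u => E u r i); last first.
    apply/funext => u.
    transitivity (col i (x' u) r 0 - col i (flow x j u) r 0); first by [].
    by rewrite /E !mxE.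
  move=> /is_derive_eq; apply; rewrite -(leader_col_flow t hj ki) /E !mxE.
  by ring.
have cN : {within `[s, s + h], continuous (fun t => `|E t|)}.
  by move=> t; apply: continuous_comp (cE t) _; exact: norm_continuous.
have [|c] := EVT_max _ cN; first by rewrite lerDl ltW.
rewrite in_itv/= => /andP[sc ch] cmax.
suff N0 : `|E c| <= 0.
  exists h => // t st tT; apply/eqP; rewrite -subr_eq0 -normr_le0.
  by apply: le_trans (cmax t _) N0; rewrite in_itv.
have Es : E s = 0 by rewrite /E x's subrr.
have [sc'|/eqP ne] := eqVneq s c; first by rewrite -sc' Es normr0.
have {}sc : s < c by rewrite lt_neqAle sc andbT; apply/eqP.
(* Each entry is bounded by the mean value theorem: its slope is a difference of two entries of
   [E xi], at most [2 * |E c|], over a length of at most [1 / 4]. *)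
suff : `|E c| <= `|E c| / 2 by lra.
apply/mx_norm_leP => [|r i]; first by rewrite divr_ge0.
pose g t := E t r i.
have dg t : t \in `]s, c[ -> is_derive t 1 g ('D_1 g t).
  rewrite in_itv/= => /andP[st tc]; apply: derivableP.
  have [|k /(_ r) [dEk _]//] := dE t i; by rewrite st (lt_le_trans tc).
have cg : {within `[s, c], continuous g}.
  have sub : `[s, c] `<=` `[s, s + h].
    by move=> t /=; rewrite !in_itv/= => /andP[-> tc]; exact: le_trans ch.
  apply: continuous_subspaceW sub _ => t.
  apply: (continuous_comp (g := fun M : 'M[R]_(d, n) => M r i)) (cE t) _.
  exact: coord_continuous.
have [xi] := MVT sc dg cg; rewrite in_itv/= => /andP[sxi xic].
have xih : s < xi < s + h by rewrite sxi (lt_le_trans xic).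
have [k /(_ r) dk] := dE xi i xih.
have -> : g s = 0 by rewrite /g Es mxE.
rewrite subr0 (derive_val (is_derive := dk)) -/(g c) => ->.
have xile : `|E xi| <= `|E c|.
  by apply: cmax; rewrite in_itv/= (ltW sxi) ltW//; case/andP: xih.
have N0 : 0 <= `|E c| by [].
have /(_ xile) := (mx_norm_leP (E xi) N0).1 => hxi.
rewrite normrM (ger0_norm (x := c - s)) ?subr_ge0 ?(ltW sc)//.
have h2 : `|E xi r k - E xi r i| <= `|E c| + `|E c|.
  by apply: le_trans (ler_normB _ _) _; rewrite lerD.
have cs4 : c - s <= 1 / 4 by lra.
apply: le_trans (ler_pM _ _ h2 cs4) _ => //; first by rewrite subr_ge0 ltW.
lra.
Qed.

Lemma solution_unique {R : realType} {d n : nat} {B : 'M[R]_d}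
    {x : 'M[R]_(d, n)} {j : 'I_n -> 'I_n} {T : R} {x' : R -> 'M[R]_(d, n)} :
  leader B x j -> solution B T x x' -> forall t, 0 <= t <= T ->
  x' t = flow x j t.
Proof.
move=> hj sx'; apply: (eq_on_segment T x' (flow x j)).
- by case: sx'.
- by apply: continuous_subspaceT; exact: flow_continuous.
- by case: sx' => _ -> _; rewrite flow0.
- by move=> s sT; exact: (solution_unique_step hj sx' sT).
Qed.

(** * Continuity in the initial data and conclusion *)

(** As [j] and [l] give the same targets at [x], each entry of the difference is a convex
    combination of two entries of [x - y]. *)
Lemma dist_flow {R : realType} {d n : nat} {B : 'M[R]_d} {x y : 'M[R]_(d, n)}
    {j l : 'I_n -> 'I_n} {t : R} :
  (forall i, col (l i) x = col (j i) x) -> 0 <= t ->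
  `|flow x j t - flow y l t| <= `|x - y|.
Proof.
move=> lj t0; apply/mx_norm_leP => // r i.
have hxy := (mx_norm_leP (x - y) (normr_ge0 (x - y))).1 (lexx _).
have -> : (flow x j t - flow y l t) r i
  = expR (- t) * (x - y) r i + (1 - expR (- t)) * (x - y) r (l i).
  have /colP/(_ r) := lj i; rewrite !mxE => ->; ring.
have e0 := expR_ge0 (- t).
have e1 : 0 <= 1 - expR (- t) by rewrite subr_ge0 expR_le1 oppr_le0.
apply: le_trans (ler_normD _ _) _.
rewrite !normrM (ger0_norm e0) (ger0_norm e1).
apply: (@le_trans _ _ (expR (- t) * `|x - y| + (1 - expR (- t)) * `|x - y|)).
  by apply: lerD; apply: ler_wpM2l.
by rewrite -mulrDl addrC subrK mul1r.
Qed.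

Theorem theorem4p8 (R : realType) (d n : nat) (B : 'M[R]_d)
    (hB : sym_posdef B) (x0 : 'M[R]_(d, n)) (hx0 : admissible B x0)
    (T : R) (hT : 0 < T) :
  (exists x : R -> 'M[R]_(d, n),
     [/\ solution B T x0 x,
         forall x' : R -> 'M[R]_(d, n), solution B T x0 x' ->
           {in `[0, T], x' =1 x} &
         forall (i : 'I_n) (t : R), 0 <= t <= T ->
           conv_hull (points x0) (col i (x t))]) /\
  (forall S : 'M[R]_(d, n) -> {uniform` `[0, T] -> 'M[R]_(d, n)},
     (forall y0, admissible B y0 -> solution B T y0 (S y0)) ->
     {within @admissible R d n B, continuous S}).
Proof.
split.
  have [j hj] := admissible_leader hx0.
  exists (flow x0 j); split; first exact: solution_flow.
  - move=> x' sx' t; rewrite in_itv/=; exact: (solution_unique hj sx').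
  - by move=> i t /andP[t0 _]; exact: conv_hull_flow.
move=> S hS; apply/subspace_continuousP => x ax.
have [j hj] := admissible_leader ax.
move=> P /uniform_nbhs[E [entE EP]].
move: entE; rewrite -entourage_ballE => -[e /= e0 eE].
have near_x : \forall y \near x, ball x e y by exact: nbhsx_ballx.
apply: filterS2 near_x (leader_near hj) => y xy hy ay.
have [l hl] := admissible_leader ay.
apply: EP => t /=; rewrite in_itv/= => tT; apply: eE => /=.
rewrite -[ball _ _ _]/(ball (S x t) e (S y t)).
(* By uniqueness, any selection [S] of solutions is given on [[0, T]] by explicit flows. *)
rewrite (solution_unique hj (hS x ax) t tT) (solution_unique hl (hS y ay) t tT).
move: xy; rewrite !mx_norm_ball /ball_/=; apply: le_lt_trans.
apply: (dist_flow (B := B)); last by case/andP: tT.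
(* If the targets differed at [x], then at the nearby [y] the point [j i] would strictly beat [l i],
   contradicting that [l i] is the maximizer there. *)
move=> i; apply: contrapT => ne.
have := hy i (l i) ne; have [->|/eqP ne'] := eqVneq (col (j i) y) (col (l i) y).
  by rewrite ltxx.
by move=> /lt_trans /(_ (hl.1 i (j i) ne')); rewrite ltxx.
Qed.
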